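(* Let $\alpha: I\to\mathbb{R}^3$ be a Frenet curve in $E^3$ parametrized by arc length. Then an osculating-direction curve of $\alpha$ cannot be a general helix.
   Context: $E^3$ is Euclidean 3-space, $I\subset\mathbb{R}$ is a (nonempty) open interval and curves are sufficiently smooth. A unit speed curve $\alpha: I\to\mathbb{R}^3$ is a Frenet curve if its curvature $\kappa(s)=\|\alpha''(s)\|$ is nowhere zero; its Frenet frame is $T=\alpha'$, $N=\alpha''/\kappa$, $B=T\times N$, with $T'=\kappa N$, $N'=-\kappa T+\tau B$, $B'=-\tau N$, where $\tau$ is the torsion. Osculating-direction curve: let $X$ be a unit vector field along $\alpha$ of the form $X(s)=u(s)T(s)+v(s)N(s)$ with $u,v$ differentiable, $u(s)\neq0$, $v(s)\neq0$, and such that $X'(s)$ is a nonzero multiple of $B(s)$ for every $s\in I$. An integral curve $\gamma: I\to\mathbb{R}^3$ of $X$, i.e. a curve with $\gamma'(s)=X(s)$, is called an osculating-direction curve of $\alpha$, and $\alpha$ is called an osculating-donor curve of $\gamma$. A unit speed curve with unit tangent $T$ is a general helix if there is a constant (unit) vector $w$ such that $\langle T,w\rangle=\cos\theta$ is constant along the curve with $\theta\neq\pi/2$. *)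

(* Defs.v *)
From mathcomp Require Import all_boot all_order all_algebra.
From mathcomp Require Import all_classical all_reals all_analysis.
Import numFieldNormedType.Exports.
Import Order.TTheory GRing.Theory Num.Theory.

Set Implicit Arguments.
Unset Strict Implicit.
Unset Printing Implicit Defensive.

Local Open Scope classical_set_scope.
Local Open Scope ring_scope.

(* The library norm `|u| on 'rV[R]_3 is the sup norm; lengths and angles use
   the Euclidean structure below. The two norms being equivalent, derivatives
   of curves are the library ones. *)
Definition dot3 (R : realType) (u v : 'rV[R]_3) : R :=
  \sum_(i < 3) u 0 i * v 0 i.

Definition enorm3 (R : realType) (u : 'rV[R]_3) : R := Num.sqrt (dot3 u u).

(* Indices of coordinates are taken modulo 3. *)
Definition cross3 (R : realType) (u v : 'rV[R]_3) : 'rV[R]_3 :=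
  \row_(i < 3) (u 0 (i + 1) * v 0 (i + 2) - u 0 (i + 2) * v 0 (i + 1)).

(* A curve on an open interval I is a total function R -> 'rV[R]_3 of which
   only the values on I are constrained; as I is open, the derivatives at the
   points of I depend on these values only. *)
Section Curves.
Context (R : realType).
Implicit Types (I : set R) (alpha gamma X : R -> 'rV[R]_3).

Definition unit_speed I alpha :=
  forall s, I s -> derivable alpha s 1 /\ enorm3 (derive1 alpha s) = 1.

Definition tangent alpha : R -> 'rV[R]_3 := derive1 alpha.

Definition curvature alpha (s : R) : R := enorm3 (derive1n 2 alpha s).

Definition normal alpha (s : R) : 'rV[R]_3 :=
  (curvature alpha s)^-1 *: derive1n 2 alpha s.

Definition binormal alpha (s : R) : 'rV[R]_3 :=
  cross3 (tangent alpha s) (normal alpha s).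

(* Three derivatives are what the Frenet equations (T, N and B differentiable)
   require. *)
Definition frenet_curve I alpha :=
  [/\ unit_speed I alpha,
      forall s, I s -> forall k, (k < 3)%N -> derivable (derive1n k alpha) s 1 &
      forall s, I s -> curvature alpha s != 0].

Definition osculating_direction_field I alpha X :=
  (exists u v : R -> R, forall s, I s ->
    [/\ derivable u s 1, derivable v s 1, u s != 0, v s != 0 &
        X s = u s *: tangent alpha s + v s *: normal alpha s]) /\
  (forall s, I s -> enorm3 (X s) = 1 /\
    exists2 c : R, c != 0 & is_derive s 1 X (c *: binormal alpha s)).

Definition integral_curve I X gamma :=
  forall s, I s -> is_derive s 1 gamma (X s).

Definition osculating_direction_curve I alpha gamma :=
  exists2 X, osculating_direction_field I alpha X & integral_curve I X gamma.

Definition general_helix I gamma :=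
  unit_speed I gamma /\
  exists (w : 'rV[R]_3) (theta : R),
    [/\ enorm3 w = 1, 0 <= theta <= pi, theta != pi / 2 &
        forall s, I s -> dot3 (tangent gamma s) w = cos theta].

End Curves.

(* Main.v *)
(* Let X = u T + v N be the tangent field of the osculating-direction curve and
   suppose that <X, w> is constant. As X' is a nonzero multiple of B, the vector
   w is orthogonal to B. Differentiating <X, B> = 0 shows that the torsion does
   not vanish, so <B, w> = 0 gives <N, w> = 0 and then <T, w> = 0, hence w = 0.
   The argument is run on the first three derivatives a, b, e of alpha instead
   of T, N, B, so that neither u, v nor the curvature gets differentiated. *)
Require Import Defs.
From mathcomp Require Import all_boot all_order all_algebra.
From mathcomp Require Import all_classical all_reals all_analysis.
From mathcomp Require Import ring.
Import numFieldNormedType.Exports.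
Import Order.TTheory GRing.Theory Num.Theory.

Set Implicit Arguments.
Unset Strict Implicit.
Unset Printing Implicit Defensive.

Local Open Scope classical_set_scope.
Local Open Scope ring_scope.

Lemma dot3E (R : realType) (u v : 'rV[R]_3) :
  dot3 u v = u 0 0 * v 0 0 + u 0 1 * v 0 1 + u 0 2 * v 0 2.
Proof.
rewrite /dot3 !big_ord_recl big_ord0 addr0 addrA.
by congr (_ * _ + _ * _ + _ * _); congr (_ 0 _); apply/val_inj.
Qed.

Lemma cross3E (R : realType) (u v : 'rV[R]_3) :
  (cross3 u v 0 0 = u 0 1 * v 0 2 - u 0 2 * v 0 1) *
  (cross3 u v 0 1 = u 0 2 * v 0 0 - u 0 0 * v 0 2) *
  (cross3 u v 0 2 = u 0 0 * v 0 1 - u 0 1 * v 0 0).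
Proof.
by do 2?split; rewrite mxE; congr (_ * _ - _ * _); congr (_ 0 _); apply/val_inj.
Qed.

Lemma row3P (R : realType) (u v : 'rV[R]_3) :
  u 0 0 = v 0 0 -> u 0 1 = v 0 1 -> u 0 2 = v 0 2 -> u = v.
Proof.
move=> h0 h1 h2; apply/rowP; case=> [[|[|[|//]]] h].
- by rewrite (_ : Ordinal h = 0) //; apply/val_inj.
- by rewrite (_ : Ordinal h = 1) //; apply/val_inj.
- by rewrite (_ : Ordinal h = 2) //; apply/val_inj.
Qed.

(** Lagrange's identity; for a unit [a] orthogonal to [b] the right side is just [dot3 b b]. *)
Lemma dot3_cross3_sqr (R : realType) (a b : 'rV[R]_3) :
  dot3 (cross3 a b) (cross3 a b) = dot3 a a * dot3 b b - dot3 a b ^+ 2.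
Proof. by rewrite !(dot3E, cross3E, mxE); ring. Qed.

Lemma dot3Dl (R : realType) (u v w : 'rV[R]_3) :
  dot3 (u + v) w = dot3 u w + dot3 v w.
Proof. by rewrite !dot3E !mxE; ring. Qed.

Lemma dot3Zl (R : realType) (k : R) (u w : 'rV[R]_3) :
  dot3 (k *: u) w = k * dot3 u w.
Proof. by rewrite !dot3E !mxE; ring. Qed.

Lemma dot30l (R : realType) (w : 'rV[R]_3) : dot3 0 w = 0.
Proof. by rewrite dot3E !mxE; ring. Qed.

Lemma dot3C (R : realType) (u v : 'rV[R]_3) : dot3 u v = dot3 v u.
Proof. by rewrite !dot3E; ring. Qed.

Lemma cross3Zr (R : realType) (k : R) (u v : 'rV[R]_3) :
  cross3 u (k *: v) = k *: cross3 u v.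
Proof. by apply/rowP => i; rewrite !mxE; ring. Qed.

Lemma cross3vv (R : realType) (u : 'rV[R]_3) : cross3 u u = 0.
Proof. by apply/rowP => i; rewrite !mxE; ring. Qed.

Lemma cross3C (R : realType) (u v : 'rV[R]_3) : cross3 u v = - cross3 v u.
Proof. by apply/rowP => i; rewrite !mxE; ring. Qed.

Lemma dot3_cross3l (R : realType) (u v : 'rV[R]_3) : dot3 u (cross3 u v) = 0.
Proof. by rewrite !(dot3E, cross3E); ring. Qed.

Lemma dot3_cross3r (R : realType) (u v : 'rV[R]_3) : dot3 v (cross3 u v) = 0.
Proof. by rewrite !(dot3E, cross3E); ring. Qed.

Lemma dot3_cross3CA (R : realType) (u v w : 'rV[R]_3) :
  dot3 v (cross3 u w) = - dot3 (cross3 u v) w.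
Proof. by rewrite !(dot3E, cross3E); ring. Qed.

(** Cramer's rule with the determinant cleared: a polynomial identity, valid even when [a], [b], [e]
    are dependent. *)
Lemma cramer3 (R : realType) (a b e w : 'rV[R]_3) :
  dot3 (cross3 a b) e *: w = dot3 (cross3 b e) w *: a
    + dot3 (cross3 e a) w *: b + dot3 (cross3 a b) w *: e.
Proof. by apply: row3P; rewrite !(dot3E, cross3E, mxE); ring. Qed.

Lemma is_derive_mxP (R : realType) (m n : nat) (M : R -> 'M[R]_(m, n)) (s : R)
    (D : 'M[R]_(m, n)) :
  is_derive s 1 M D <->
  forall i j, is_derive s 1 (fun t => M t i j) (D i j).
Proof.
split=> [[dM <-] i j|dM].
  rewrite derive_mx// mxE; apply: derivableP.
  exact: ((derivable_mxP _ _ _).1 dM).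
have dM' : derivable M s 1 by apply/derivable_mxP => i j; case: (dM i j).
split=> //; rewrite derive_mx//; apply/matrixP => i j; rewrite mxE.
by case: (dM i j).
Qed.

Lemma is_derive_dot3 (R : realType) (F G : R -> 'rV[R]_3) (s : R)
    (dF dG : 'rV[R]_3) :
  is_derive s 1 F dF -> is_derive s 1 G dG ->
  is_derive s 1 (fun t => dot3 (F t) (G t)) (dot3 dF (G s) + dot3 (F s) dG).
Proof.
move=> /is_derive_mxP hF /is_derive_mxP hG.
rewrite (_ : (fun t => _) =
  \sum_(i < 3) ((fun t => F t 0 i) * (fun t => G t 0 i))); last first.
  by apply/funext => t; rewrite fct_sumE.
apply: is_derive_eq; rewrite /dot3 -big_split/=; apply: eq_bigr => i _.
by rewrite addrC /GRing.scale/=; congr (_ + _); rewrite mulrC.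
Qed.

Lemma is_derive_dot3l (R : realType) (F : R -> 'rV[R]_3) (w : 'rV[R]_3)
    (s : R) (dF : 'rV[R]_3) :
  is_derive s 1 F dF -> is_derive s 1 (fun t => dot3 (F t) w) (dot3 dF w).
Proof.
move=> hF; have := is_derive_dot3 hF (is_derive_cst w s 1).
by rewrite [X in _ + X]dot3C dot30l addr0.
Qed.

Lemma is_derive_cross3 (R : realType) (F G : R -> 'rV[R]_3) (s : R)
    (dF dG : 'rV[R]_3) :
  is_derive s 1 F dF -> is_derive s 1 G dG ->
  is_derive s 1 (fun t => cross3 (F t) (G t))
    (cross3 dF (G s) + cross3 (F s) dG).
Proof.
move=> /is_derive_mxP hF /is_derive_mxP hG; apply/is_derive_mxP => i j.
rewrite (_ : (fun t => _) =
  (fun t => F t 0 (j + 1)) * (fun t => G t 0 (j + 2)) -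
  (fun t => F t 0 (j + 2)) * (fun t => G t 0 (j + 1))); last first.
  by apply/funext => t; rewrite mxE.
by apply: is_derive_eq; rewrite !mxE /GRing.scale/=; ring.
Qed.

(** Openness of [I] makes [f] agree with a constant near [s], whatever its values outside [I]. *)
Lemma is_derive_cst_on (R : realType) (I : set R) (f : R -> R) (c s d : R) :
  open I -> I s -> (forall t, I t -> f t = c) -> is_derive s 1 f d -> d = 0.
Proof.
move=> oI Is fc df.
have cf : is_derive s 1 f 0.
  apply: (@near_eq_is_derive _ _ _ (cst c)).
  by near=> t; rewrite fc//; near: t; exact: open_nbhs_nbhs.
by rewrite -(@derive_val _ _ _ _ _ _ _ df) (@derive_val _ _ _ _ _ _ _ cf).
Unshelve. all: by end_near. Qed.

Lemma sqr_enorm3 (R : realType) (u : 'rV[R]_3) : enorm3 u ^+ 2 = dot3 u u.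
Proof.
by rewrite sqr_sqrtr// /dot3 sumr_ge0// => i _; rewrite -expr2 sqr_ge0.
Qed.

(** For a unit speed curve with derivatives [a], [b], [e], the vector [cross3 a b] is the curvature
    times the binormal. Only [a], [b], [cross3 a b] and [X] get differentiated, so three derivatives
    of the curve suffice. *)
Lemma osculating_constant_dot3 (R : realType) (I : set R)
    (a b e X : R -> 'rV[R]_3) (p q : R -> R) (w : 'rV[R]_3) (c : R) :
  I !=set0 -> open I ->
  (forall s, I s -> is_derive s 1 a (b s)) ->
  (forall s, I s -> is_derive s 1 b (e s)) ->
  (forall s, I s -> dot3 (a s) (a s) = 1) ->
  (forall s, I s -> dot3 (b s) (b s) != 0) ->
  (forall s, I s -> X s = p s *: a s + q s *: b s) ->
  (forall s, I s ->
    exists2 k, k != 0 & is_derive s 1 X (k *: cross3 (a s) (b s))) ->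
  (forall s, I s -> dot3 (X s) w = c) -> w = 0.
Proof.
move=> I_nonempty I_open da db aa bb XE dX Xw.
have ab s : I s -> dot3 (a s) (b s) = 0.
  move=> Is.
  have := is_derive_cst_on I_open Is aa (is_derive_dot3 (da s Is) (da s Is)).
  by rewrite (dot3C (b s)) => /eqP; rewrite -mulr2n mulrn_eq0 => /eqP.
have ae s : I s -> dot3 (a s) (e s) = - dot3 (b s) (b s).
  move=> Is.
  have := is_derive_cst_on I_open Is ab (is_derive_dot3 (da s Is) (db s Is)).
  by move/eqP; rewrite addrC addr_eq0 => /eqP.
have dab s : I s ->
    is_derive s 1 (fun t => cross3 (a t) (b t)) (cross3 (a s) (e s)).
  move=> Is; have := is_derive_cross3 (da s Is) (db s Is).
  by rewrite cross3vv add0r.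
have Xab s : I s -> dot3 (X s) (cross3 (a s) (b s)) = 0.
  move=> Is.
  by rewrite XE// dot3Dl !dot3Zl dot3_cross3l dot3_cross3r !mulr0 addr0.
(* Differentiating [Xab] turns the hypothesis [k != 0] on [X'] into the
   nonvanishing of the torsion. *)
have det s : I s -> dot3 (cross3 (a s) (b s)) (e s) != 0.
  move=> Is; apply/eqP => abe.
  have [k k0 hX] := dX s Is.
  have := is_derive_cst_on I_open Is Xab (is_derive_dot3 hX (dab s Is)).
  rewrite dot3Zl dot3_cross3_sqr aa// ab// XE//.
  (* The [a] part of [X] is orthogonal to [cross3 a e], and its [b] part contributes a multiple of
     the determinant, zero by [abe]. What remains is [k * dot3 b b = 0]. *)
  rewrite dot3Dl !dot3Zl dot3_cross3l dot3_cross3CA.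
  rewrite abe oppr0 !mulr0 !addr0 mul1r expr0n subr0.
  by apply/eqP; rewrite mulf_neq0// bb.
have abw s : I s -> dot3 (cross3 (a s) (b s)) w = 0.
  move=> Is; have [k k0 hX] := dX s Is.
  have := is_derive_cst_on I_open Is Xw (is_derive_dot3l w hX).
  by rewrite dot3Zl => /eqP; rewrite mulf_eq0 (negbTE k0) => /eqP.
(* Differentiate [abw]; the term [cross3 b b] has already dropped out in [dab]. *)
have aew s : I s -> dot3 (cross3 (a s) (e s)) w = 0.
  move=> Is.
  exact: is_derive_cst_on I_open Is abw (is_derive_dot3l w (dab s Is)).
(* By [abw] and [aew], only the [a] term of Cramer's rule survives, so [w] is parallel to [a]. *)
have det_w s : I s -> dot3 (cross3 (a s) (b s)) (e s) *: w =
    dot3 (cross3 (b s) (e s)) w *: a s.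
  move=> Is; rewrite cramer3 abw// (cross3C (e s)) -scaleN1r dot3Zl aew//.
  by rewrite mulr0 !scale0r !addr0.
have bw s : I s -> dot3 (b s) w = 0.
  move=> Is; have /(congr1 (fun x : 'rV[R]_3 => dot3 x (b s))) := det_w s Is.
  rewrite !dot3Zl ab// mulr0 [dot3 w _]dot3C => /eqP.
  by rewrite mulf_eq0 (negbTE (det s Is)) => /eqP.
have ew s : I s -> dot3 (e s) w = 0.
  move=> Is.
  exact: is_derive_cst_on I_open Is bw (is_derive_dot3l w (db s Is)).
have [s Is] := I_nonempty.
(* Pair [det_w] with [e]: the left side vanishes by [ew], while [dot3 a e = - dot3 b b] is
   nonzero. *)
have bew : dot3 (cross3 (b s) (e s)) w = 0.
  have /(congr1 (fun x : 'rV[R]_3 => dot3 x (e s))) := det_w s Is.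
  rewrite !dot3Zl ae// [dot3 w _]dot3C ew// mulr0 => /esym/eqP.
  by rewrite mulf_eq0 oppr_eq0 (negbTE (bb s Is)) orbF => /eqP.
have /eqP := det_w s Is.
by rewrite bew scale0r scaler_eq0 (negbTE (det s Is)) => /eqP.
Qed.

Theorem theorem4p2 (R : realType) (I : set R) (alpha gamma : R -> 'rV[R]_3)
    (I_nonempty : I !=set0) (I_open : open I) (I_interval : is_interval I)
    (alpha_frenet : frenet_curve I alpha)
    (gamma_osc : osculating_direction_curve I alpha gamma) :
  ~ general_helix I gamma.
Proof.
case=> _ [w] [theta] [w1 _ _ gw].
have [X [[u [v Xuv]] dX] dgamma] := gamma_osc.
have [speed smooth curv] := alpha_frenet.
suff w0 : w = 0.
  have := sqr_enorm3 w; rewrite w1 w0 dot30l expr1n.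
  by move=> /eqP; rewrite oner_eq0.
(* The normal is the second derivative over the curvature, hence the coefficient
   [v s / curvature alpha s]. *)
apply: (@osculating_constant_dot3 _ I (derive1 alpha) (derive1n 2 alpha)
  (derive1n 3 alpha) X u (fun s => v s / curvature alpha s) w (cos theta)
  I_nonempty I_open).
- move=> s Is; rewrite derive1nS derive1n1 derive1E.
  by apply: derivableP; exact: (smooth s Is 1%N).
- move=> s Is; rewrite (derive1nS _ 2) derive1E.
  by apply: derivableP; exact: (smooth s Is 2%N).
- by move=> s Is; rewrite -sqr_enorm3 (speed s Is).2 expr1n.
- by move=> s Is; rewrite -sqr_enorm3 sqrf_eq0; exact: curv.
- by move=> s Is; have [_ _ _ _ ->] := Xuv s Is; rewrite /normal scalerA.
- move=> s Is; have [_ [c c0]] := dX s Is.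
  rewrite /binormal /normal cross3Zr scalerA => h.
  (* The factor [1 / curvature] comes out of the normal inside the binormal. *)
  by exists (c / curvature alpha s) => //; rewrite mulf_neq0// invr_neq0// curv.
- move=> s Is; rewrite -(gw s Is) /tangent derive1E.
  by have [_ ->] := dgamma s Is.
Qed.
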